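(* Let $X$ be a scheme, and let $\mathrm{Irr}(X)$ be the set of its irreducible components. a) $X$ is locally irreducible if and only if it is pointwise irreducible and $\mathrm{Irr}(X)$ is locally finite. b) $X$ is irreducible if and only if it is nonempty, connected and pointwise irreducible and $\mathrm{Irr}(X)$ is locally finite.
   Context: A topological space is irreducible if the intersection of finitely many nonempty open subsets is nonempty (so irreducible spaces are nonempty). $\mathrm{Irr}(X)$ is the set of $\subseteq$-maximal irreducible subsets of (the underlying space of) $X$; it is locally finite if every point of $X$ has a neighbourhood meeting only finitely many elements of $\mathrm{Irr}(X)$. A space is locally irreducible if every point has an irreducible neighbourhood (equivalently, an irreducible open neighbourhood). A scheme is irreducible or locally irreducible if its underlying topological space is so. A commutative ring is irreducible if its spectrum is irreducible, equivalently if it has precisely one minimal prime ideal. A scheme $X$ is pointwise irreducible if the ring $\mathscr{O}_{X,x}$ is irreducible for every $x\in X$. The empty space is considered connected. *)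

(* Defs.v *)
From HB Require Import structures.
From mathcomp Require Import all_boot all_algebra.
From mathcomp Require Import all_classical topology.
From mathcomp Require Import ring.

Set Implicit Arguments.
Unset Strict Implicit.
Unset Printing Implicit Defensive.

Import GRing.Theory.

Local Open Scope classical_set_scope.
Local Open Scope ring_scope.
Local Open Scope quotient_scope.

(* A commutative ring up to an equivalence relation; the local rings [A_p] and
   the stalks of a ringed space are obtained as quotients of such data. *)
Record preRing := PreRing {
  carrier : Type;
  eqv : carrier -> carrier -> Prop;
  pzero : carrier;
  popp : carrier -> carrier;
  padd : carrier -> carrier -> carrier;
  pone : carrier;
  pmul : carrier -> carrier -> carrier;
  eqv_refl : forall x, eqv x x;
  eqv_sym : forall x y, eqv x y -> eqv y x;
  eqv_trans : forall x y z, eqv x y -> eqv y z -> eqv x z;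
  popp_eqv : forall x x', eqv x x' -> eqv (popp x) (popp x');
  padd_eqv : forall x x' y y',
    eqv x x' -> eqv y y' -> eqv (padd x y) (padd x' y');
  pmul_eqv : forall x x' y y',
    eqv x x' -> eqv y y' -> eqv (pmul x y) (pmul x' y');
  paddA : forall x y z, eqv (padd x (padd y z)) (padd (padd x y) z);
  paddC : forall x y, eqv (padd x y) (padd y x);
  padd0 : forall x, eqv (padd pzero x) x;
  paddN : forall x, eqv (padd (popp x) x) pzero;
  pmulA : forall x y z, eqv (pmul x (pmul y z)) (pmul (pmul x y) z);
  pmulC : forall x y, eqv (pmul x y) (pmul y x);
  pmul1 : forall x, eqv (pmul pone x) x;
  pmulD : forall x y z,
    eqv (pmul (padd x y) z) (padd (pmul x z) (pmul y z))
}.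

Section QuotientRing.
Variable S : preRing.
Let T : choiceType := {classic carrier S}.

Definition eqvb (x y : T) : bool := `[< @eqv S x y >].

Lemma eqvb_is_equiv : equiv_class_of eqvb.
Proof.
split=> [x|x y|y x z].
- exact/asboolP/eqv_refl.
- by apply/asboolP/asboolP; exact: eqv_sym.
- by move=> /asboolP xy /asboolP yz; apply/asboolP/(eqv_trans xy yz).
Qed.

Canonical eqvb_equiv := EquivRelPack eqvb_is_equiv.

Definition quotRing := {eq_quot eqvb_equiv}.

HB.instance Definition _ := Choice.on quotRing.
HB.instance Definition _ := EqQuotient.on quotRing.

Definition class_of (x : carrier S) : quotRing := \pi_quotRing (x : T).
Definition rep (q : quotRing) : carrier S := repr q.

Lemma class_ofE x y : class_of x = class_of y <-> eqv x y.
Proof.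
split; first by move=> /eqquotP /= /asboolP.
by move=> xy; apply/eqquotP/asboolP.
Qed.

Lemma repK q : class_of (rep q) = q. Proof. exact: reprK. Qed.

Lemma rep_class x : eqv (rep (class_of x)) x.
Proof. by apply/class_ofE; rewrite repK. Qed.

Definition qadd (p q : quotRing) := class_of (padd (rep p) (rep q)).
Definition qmul (p q : quotRing) := class_of (pmul (rep p) (rep q)).
Definition qopp (p : quotRing) := class_of (popp (rep p)).

Lemma qaddE x y : qadd (class_of x) (class_of y) = class_of (padd x y).
Proof. by apply/class_ofE/padd_eqv; exact: rep_class. Qed.

Lemma qmulE x y : qmul (class_of x) (class_of y) = class_of (pmul x y).
Proof. by apply/class_ofE/pmul_eqv; exact: rep_class. Qed.

Lemma qoppE x : qopp (class_of x) = class_of (popp x).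
Proof. by apply/class_ofE/popp_eqv; exact: rep_class. Qed.

Fact qaddA : associative qadd.
Proof.
move=> p q r; rewrite -(repK p) -(repK q) -(repK r) !qaddE.
exact/class_ofE/paddA.
Qed.

Fact qaddC : commutative qadd.
Proof. by move=> p q; exact/class_ofE/paddC. Qed.

Fact qadd0 : left_id (class_of (pzero S)) qadd.
Proof. by move=> p; rewrite -(repK p) qaddE; exact/class_ofE/padd0. Qed.

Fact qaddN : left_inverse (class_of (pzero S)) qopp qadd.
Proof. by move=> p; rewrite -(repK p) qoppE qaddE; exact/class_ofE/paddN. Qed.

Fact qmulA : associative qmul.
Proof.
move=> p q r; rewrite -(repK p) -(repK q) -(repK r) !qmulE.
exact/class_ofE/pmulA.
Qed.

Fact qmulC : commutative qmul.
Proof. by move=> p q; exact/class_ofE/pmulC. Qed.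

Fact qmul1 : left_id (class_of (pone S)) qmul.
Proof. by move=> p; rewrite -(repK p) qmulE; exact/class_ofE/pmul1. Qed.

Fact qmulD : left_distributive qmul qadd.
Proof.
move=> p q r; rewrite -(repK p) -(repK q) -(repK r) !(qaddE, qmulE).
exact/class_ofE/pmulD.
Qed.

HB.instance Definition _ := GRing.isZmodule.Build quotRing
  qaddA qaddC qadd0 qaddN.
HB.instance Definition _ := GRing.Zmodule_isComPzRing.Build quotRing
  qmulA qmulC qmul1 qmulD.

Lemma class_of0 : class_of (pzero S) = 0. Proof. by []. Qed.
Lemma class_of1 : class_of (pone S) = 1. Proof. by []. Qed.
Lemma class_ofN x : class_of (popp x) = - class_of x.
Proof. by rewrite -qoppE. Qed.
Lemma class_ofD x y : class_of (padd x y) = class_of x + class_of y.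
Proof. by rewrite -qaddE. Qed.
Lemma class_ofM x y : class_of (pmul x y) = class_of x * class_of y.
Proof. by rewrite -qmulE. Qed.

End QuotientRing.

(* The intersection of the empty family is the whole space, so an irreducible
   space is nonempty. *)
Definition irreducible_space (T : topologicalType) : Prop :=
  forall F : set (set T), finite_set F ->
    (forall U, F U -> open U /\ U !=set0) -> \bigcap_(U in F) U !=set0.

(* [set_type Z] carries the topology induced from [T]. *)
Definition irreducible_set (T : topologicalType) (Z : set T) : Prop :=
  irreducible_space (set_type Z).

Definition Irr (T : topologicalType) : set (set T) :=
  [set Z | irreducible_set Z /\
           forall Z', irreducible_set Z' -> Z `<=` Z' -> Z' = Z].

Arguments Irr T : clear implicits.

Definition locally_finite (T : topologicalType) (F : set (set T)) : Prop :=
  forall x : T, exists2 N, nbhs x N & finite_set [set Z | F Z /\ Z `&` N !=set0].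

Definition locally_irreducible (T : topologicalType) : Prop :=
  forall x : T, exists2 N, nbhs x N & irreducible_set N.

Record opens (T : topologicalType) := Opens {
  oset :> set T;
  oset_open : open oset
}.

Definition opensI (T : topologicalType) (U V : opens T) : opens T :=
  Opens (openI (oset_open U) (oset_open V)).

Definition opensT (T : topologicalType) : opens T := Opens (@openT T).

Definition preimage_opens (S T : topologicalType) (f : S -> T)
    (cf : continuous f) (V : opens T) : opens S :=
  Opens (open_comp (fun x _ => cf x) (oset_open V)).

Lemma open_image_val (T : topologicalType) (U : opens T)
  (V : opens (set_type U)) : open (set_val @` (V : set (set_type U))).
Proof.
case: V => V /= [W oW WV].
suff -> : set_val @` V = W `&` U by apply: openI => //; exact: oset_open.
rewrite -WV; apply/seteqP; split=> [_ [x Wx <-]|x [Wx Ux]].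
  by split=> //; exact: set_valP.
by exists (SigSub (mem_set Ux)).
Qed.

Definition image_opens (T : topologicalType) (U : opens T)
    (V : opens (set_type U)) : opens T :=
  Opens (open_image_val V).

Lemma preimage_opensS (S T : topologicalType) (f : S -> T) (cf : continuous f)
    (V W : opens T) : W `<=` V -> preimage_opens cf W `<=` preimage_opens cf V.
Proof. exact: preimage_subset. Qed.

Lemma image_opensS (T : topologicalType) (U : opens T)
    (V W : opens (set_type U)) : W `<=` V -> image_opens W `<=` image_opens V.
Proof. exact: image_subset. Qed.

Definition is_ideal (A : comPzRingType) (I : set A) : Prop :=
  [/\ I 0, forall x y, I x -> I y -> I (x + y) & forall a x, I x -> I (a * x)].

Definition is_prime (A : comPzRingType) (P : set A) : Prop :=
  [/\ is_ideal P, ~ P 1 & forall x y, P (x * y) -> P x \/ P y].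

Definition is_maximal (A : comPzRingType) (M : set A) : Prop :=
  [/\ is_ideal M, ~ M 1 &
      forall J, is_ideal J -> ~ J 1 -> M `<=` J -> J = M].

Definition local_ring (A : comPzRingType) : Prop :=
  exists! M : set A, is_maximal M.

Record Spec (A : comPzRingType) := MkSpec {
  prime_of :> set A;
  prime_ofP : is_prime prime_of
}.

HB.instance Definition _ (A : comPzRingType) := gen_eqMixin (Spec A).
HB.instance Definition _ (A : comPzRingType) := gen_choiceMixin (Spec A).

(* The Zariski closed sets are the [V(E)], the primes containing [E]. *)
Definition zariski_open (A : comPzRingType) : set_system (Spec A) :=
  [set U | exists E : set A, U = [set p | ~ E `<=` prime_of p]].

Section Zariski.
Variable A : comPzRingType.

Fact zariski_openT : @zariski_open A setT.
Proof.
exists [set 1]; apply/seteqP; split=> // p _ /(_ 1 erefl).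
by case: (prime_ofP p).
Qed.

Fact zariski_openI : setI_closed (@zariski_open A).
Proof.
move=> _ _ [E ->] [F ->].
exists [set x | exists e f, [/\ E e, F f & x = e * f]].
apply/seteqP; split=> p /=; have [[p0 pD pM] p1 pp] := prime_ofP p.
  case=> nE nF sEF; move: nE; apply=> e Ee.
  apply: contrapT => npe; apply: nF => f Ff.
  by case: (pp e f) => //; apply: sEF; exists e, f.
move=> nEF; split=> sE; apply: nEF => _ [e [f [Ee Ff ->]]].
  by rewrite mulrC; apply: pM; exact: sE.
by apply: pM; exact: sE.
Qed.

Fact zariski_open_bigU (I : Type) (f : I -> set (Spec A)) :
  (forall i, zariski_open (f i)) -> zariski_open (\bigcup_i f i).
Proof.
move=> /choice[E fE]; exists (\bigcup_i E i).
apply/seteqP; split=> [p [i _]|p /= nE].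
  by rewrite fE /= => nE sE; apply: nE => x Ex; apply: sE; exists i.
apply: contrapT => nf; apply: nE => x [i _ Ex].
apply: contrapT => npx; apply: nf; exists i => //.
by rewrite fE /= => /(_ x Ex).
Qed.

HB.instance Definition _ := isOpenTopological.Build (Spec A)
  zariski_openT zariski_openI zariski_open_bigU.

End Zariski.

Definition irreducible_ring (A : comPzRingType) : Prop :=
  irreducible_space (Spec A).

Section Localization.
Variables (A : comPzRingType) (p : Spec A).

Record fraction := Fraction {
  num : A;
  den : A;
  den_notin : ~ prime_of p den
}.

Arguments den_notin : clear implicits.

Definition frac_eqv (x y : fraction) : Prop :=
  exists2 u : A, ~ prime_of p u & u * (num x * den y - num y * den x) = 0.

Lemma notin1 : ~ prime_of p 1. Proof. by case: (prime_ofP p). Qed.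

Lemma notinM (x y : A) : ~ prime_of p x -> ~ prime_of p y -> ~ prime_of p (x * y).
Proof. by have [_ _ pp] := prime_ofP p => nx ny /pp[]. Qed.

Definition frac0 := Fraction 0 notin1.
Definition frac1 := Fraction 1 notin1.
Definition fracN (x : fraction) := Fraction (- num x) (den_notin x).
Definition fracD (x y : fraction) := Fraction
  (num x * den y + num y * den x) (notinM (den_notin x) (den_notin y)).
Definition fracM (x y : fraction) := Fraction
  (num x * num y) (notinM (den_notin x) (den_notin y)).

Lemma frac_eqv_eq x y : num x * den y = num y * den x -> frac_eqv x y.
Proof. by move=> e; exists 1; [exact: notin1 | rewrite e subrr mulr0]. Qed.

Lemma frac_eqv_refl x : frac_eqv x x. Proof. exact: frac_eqv_eq. Qed.

Lemma frac_eqv_sym x y : frac_eqv x y -> frac_eqv y x.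
Proof.
by case=> u nu e; exists u => //; rewrite -opprB mulrN e oppr0.
Qed.

Lemma frac_eqv_trans x y z : frac_eqv x y -> frac_eqv y z -> frac_eqv x z.
Proof.
case=> u nu exy [v nv eyz]; exists (u * v * den y).
  by apply: notinM; [exact: notinM | exact: den_notin].
transitivity (v * den z * (u * (num x * den y - num y * den x)) +
              u * den x * (v * (num y * den z - num z * den y))); first by ring.
by rewrite exy eyz !mulr0 addr0.
Qed.

Lemma fracN_eqv x x' : frac_eqv x x' -> frac_eqv (fracN x) (fracN x').
Proof.
case=> u nu e; exists u => //=.
transitivity (- (u * (num x * den x' - num x' * den x))); first by ring.
by rewrite e oppr0.
Qed.

Lemma fracD_eqv x x' y y' : frac_eqv x x' -> frac_eqv y y' ->
  frac_eqv (fracD x y) (fracD x' y').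
Proof.
case=> u nu e [v nv f]; exists (u * v); first exact: notinM.
rewrite /=.
transitivity
  (v * den y * den y' * (u * (num x * den x' - num x' * den x)) +
   u * den x * den x' * (v * (num y * den y' - num y' * den y))); first by ring.
by rewrite e f !mulr0 addr0.
Qed.

Lemma fracM_eqv x x' y y' : frac_eqv x x' -> frac_eqv y y' ->
  frac_eqv (fracM x y) (fracM x' y').
Proof.
case=> u nu e [v nv f]; exists (u * v); first exact: notinM.
rewrite /=.
transitivity
  (v * num y * den y' * (u * (num x * den x' - num x' * den x)) +
   u * num x' * den x * (v * (num y * den y' - num y' * den y))); first by ring.
by rewrite e f !mulr0 addr0.
Qed.

Definition frac_preRing : preRing.
Proof.
apply: (@PreRing fraction frac_eqv frac0 fracN fracD frac1 fracM
  frac_eqv_refl frac_eqv_sym frac_eqv_trans fracN_eqv fracD_eqv fracM_eqv);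
  move=> *; apply: frac_eqv_eq => /=; ring.
Defined.

Definition localization : comPzRingType := quotRing frac_preRing.

Definition frac (a s : A) (ns : ~ prime_of p s) : localization :=
  @class_of frac_preRing (Fraction a ns).

End Localization.

Record ringedSpace := RingedSpace {
  rs_space :> topologicalType;
  sec : opens rs_space -> comPzRingType;
  res : forall U V : opens rs_space, V `<=` U -> {rmorphism sec U -> sec V};
  res_id : forall (U : opens rs_space) (UU : U `<=` U) (s : sec U), res UU s = s;
  res_comp : forall (U V W : opens rs_space) (VU : V `<=` U) (WV : W `<=` V)
    (WU : W `<=` U) (s : sec U), res WV (res VU s) = res WU s;
  (* [I] may be empty, so that [sec] of the empty set is the zero ring. *)
  res_glue : forall (U : opens rs_space) (I : Type) (V : I -> opens rs_space)
    (VU : forall i, V i `<=` U), U `<=` \bigcup_i V i ->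
    forall s : (forall i, sec (V i)),
    (forall i j, res (U := V i) (V := opensI (V i) (V j)) (@subIsetl _ _ _) (s i)
               = res (U := V j) (V := opensI (V i) (V j)) (@subIsetr _ _ _) (s j)) ->
    exists! t : sec U, forall i, res (VU i) t = s i
}.

Section Stalk.
Variables (X : ringedSpace) (x : X).

Record germ := Germ {
  germ_dom : opens X;
  germ_in : oset germ_dom x;
  germ_sec : sec germ_dom
}.

Definition germ_eqv (s t : germ) : Prop :=
  exists (W : opens X) (Ws : W `<=` germ_dom s) (Wt : W `<=` germ_dom t),
    oset W x /\ res Ws (germ_sec s) = res Wt (germ_sec t).

Definition germ0 := @Germ (opensT X) I 0.
Definition germ1 := @Germ (opensT X) I 1.
Definition germN (s : germ) := Germ (germ_in s) (- germ_sec s).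

Definition germ_op (op : forall R : comPzRingType, R -> R -> R) (s t : germ) :=
  @Germ (opensI (germ_dom s) (germ_dom t)) (conj (germ_in s) (germ_in t))
    (op _ (res (V := opensI (germ_dom s) (germ_dom t)) (@subIsetl _ _ _)
             (germ_sec s))
          (res (V := opensI (germ_dom s) (germ_dom t)) (@subIsetr _ _ _)
             (germ_sec t))).
Definition germD := germ_op (fun R => @GRing.add R).
Definition germM := germ_op (fun R => @GRing.mul R).

Lemma res_irr (U V : opens X) (h h' : V `<=` U) (s : sec U) : res h s = res h' s.
Proof. by rewrite -(res_comp h (@subset_refl _ V) h') res_id. Qed.

Lemma germ_eqv_refl s : germ_eqv s s.
Proof.
exists (germ_dom s), (@subset_refl _ _), (@subset_refl _ _).
by split=> //; exact: germ_in.
Qed.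

Lemma germ_eqv_sym s t : germ_eqv s t -> germ_eqv t s.
Proof. by case=> W [Ws [Wt [Wx e]]]; exists W, Wt, Ws. Qed.

Lemma germ_eqv_trans s t r : germ_eqv s t -> germ_eqv t r -> germ_eqv s r.
Proof.
case=> W [Ws [Wt [Wx e]]] [W' [Wt' [Wr [Wx' e']]]].
pose V := opensI W W'.
have VW : V `<=` W by apply: subIsetl.
have VW' : V `<=` W' by apply: subIsetr.
exists V, (subset_trans VW Ws), (subset_trans VW' Wr); split=> //.
rewrite -(res_comp Ws VW) e -(res_comp Wr VW') -e'.
rewrite (res_comp Wt VW (subset_trans VW Wt)).
by rewrite (res_comp Wt' VW' (subset_trans VW Wt)).
Qed.

Lemma germN_eqv s s' : germ_eqv s s' -> germ_eqv (germN s) (germN s').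
Proof.
case=> W [Ws [Ws' [Wx e]]]; exists W, Ws, Ws'; split=> //=.
by rewrite !rmorphN e.
Qed.

Lemma germD_eqv s s' t t' : germ_eqv s s' -> germ_eqv t t' ->
  germ_eqv (germD s t) (germD s' t').
Proof.
case=> W [Ws [Ws' [Wx e]]] [V [Vt [Vt' [Vx f]]]].
pose WV := opensI W V.
have WVW : WV `<=` W by apply: subIsetl.
have WVV : WV `<=` V by apply: subIsetr.
have h : WV `<=` germ_dom s `&` germ_dom t.
  by move=> y [Wy Vy]; split; [exact: (Ws y Wy) | exact: (Vt y Vy)].
have h' : WV `<=` germ_dom s' `&` germ_dom t'.
  by move=> y [Wy Vy]; split; [exact: (Ws' y Wy) | exact: (Vt' y Vy)].
exists WV, h, h'; split=> //=; rewrite !rmorphD.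
congr (_ + _).
  rewrite (res_comp _ _ (subset_trans WVW Ws)) -(res_comp Ws WVW) e.
  by rewrite [RHS](res_comp _ _ (subset_trans WVW Ws')) -(res_comp Ws' WVW).
rewrite [LHS](res_comp _ _ (subset_trans WVV Vt)) -(res_comp Vt WVV) f.
by rewrite [RHS](res_comp _ _ (subset_trans WVV Vt')) -(res_comp Vt' WVV).
Qed.

Lemma germM_eqv s s' t t' : germ_eqv s s' -> germ_eqv t t' ->
  germ_eqv (germM s t) (germM s' t').
Proof.
case=> W [Ws [Ws' [Wx e]]] [V [Vt [Vt' [Vx f]]]].
pose WV := opensI W V.
have WVW : WV `<=` W by apply: subIsetl.
have WVV : WV `<=` V by apply: subIsetr.
have h : WV `<=` germ_dom s `&` germ_dom t.
  by move=> y [Wy Vy]; split; [exact: (Ws y Wy) | exact: (Vt y Vy)].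
have h' : WV `<=` germ_dom s' `&` germ_dom t'.
  by move=> y [Wy Vy]; split; [exact: (Ws' y Wy) | exact: (Vt' y Vy)].
exists WV, h, h'; split=> //=; rewrite !rmorphM.
congr (_ * _).
  rewrite (res_comp _ _ (subset_trans WVW Ws)) -(res_comp Ws WVW) e.
  by rewrite [RHS](res_comp _ _ (subset_trans WVW Ws')) -(res_comp Ws' WVW).
rewrite [LHS](res_comp _ _ (subset_trans WVV Vt)) -(res_comp Vt WVV) f.
by rewrite [RHS](res_comp _ _ (subset_trans WVV Vt')) -(res_comp Vt' WVV).
Qed.

Lemma resK (U V W : opens X) (VU : V `<=` U) (WV : W `<=` V) (s : sec U) :
  res WV (res VU s) = res (subset_trans WV VU) s.
Proof. exact: res_comp. Qed.

Fact germDA s t r : germ_eqv (germD s (germD t r)) (germD (germD s t) r).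
Proof.
have h : opensI (germ_dom s) (opensI (germ_dom t) (germ_dom r)) `<=`
  opensI (opensI (germ_dom s) (germ_dom t)) (germ_dom r) by move=> y [? []].
exists _, (@subset_refl _ _), h; split.
  by split; [|split]; exact: germ_in.
rewrite /= res_id !rmorphD /= !resK addrA.
by congr (_ + _ + _); exact: res_irr.
Qed.

Fact germDC s t : germ_eqv (germD s t) (germD t s).
Proof.
have h : opensI (germ_dom s) (germ_dom t) `<=`
  opensI (germ_dom t) (germ_dom s) by move=> y [].
exists _, (@subset_refl _ _), h; split; first by split; exact: germ_in.
rewrite /= res_id !rmorphD /= !resK addrC.
by congr (_ + _); exact: res_irr.
Qed.

Fact germD0 s : germ_eqv (germD germ0 s) s.
Proof.
have h : opensI (opensT X) (germ_dom s) `<=` germ_dom s by move=> y [].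
exists _, (@subset_refl _ _), h; split; first by split=> //; exact: germ_in.
rewrite /= res_id rmorph0 add0r; exact: res_irr.
Qed.

Fact germDN s : germ_eqv (germD (germN s) s) germ0.
Proof.
have h : opensI (germ_dom s) (germ_dom s) `<=` opensT X by [].
exists _, (@subset_refl _ _), h; split; first by split; exact: germ_in.
rewrite /= res_id rmorphN rmorph0 addrC; apply/subr0_eq.
by rewrite subr0; apply/eqP; rewrite subr_eq0; apply/eqP; exact: res_irr.
Qed.

Fact germMA s t r : germ_eqv (germM s (germM t r)) (germM (germM s t) r).
Proof.
have h : opensI (germ_dom s) (opensI (germ_dom t) (germ_dom r)) `<=`
  opensI (opensI (germ_dom s) (germ_dom t)) (germ_dom r) by move=> y [? []].
exists _, (@subset_refl _ _), h; split.
  by split; [|split]; exact: germ_in.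
rewrite /= res_id !rmorphM /= !resK mulrA.
by congr (_ * _ * _); exact: res_irr.
Qed.

Fact germMC s t : germ_eqv (germM s t) (germM t s).
Proof.
have h : opensI (germ_dom s) (germ_dom t) `<=`
  opensI (germ_dom t) (germ_dom s) by move=> y [].
exists _, (@subset_refl _ _), h; split; first by split; exact: germ_in.
rewrite /= res_id !rmorphM /= !resK mulrC.
by congr (_ * _); exact: res_irr.
Qed.

Fact germM1 s : germ_eqv (germM germ1 s) s.
Proof.
have h : opensI (opensT X) (germ_dom s) `<=` germ_dom s by move=> y [].
exists _, (@subset_refl _ _), h; split; first by split=> //; exact: germ_in.
rewrite /= res_id rmorph1 mul1r; exact: res_irr.
Qed.

Fact germMD s t r :
  germ_eqv (germM (germD s t) r) (germD (germM s r) (germM t r)).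
Proof.
have h : opensI (opensI (germ_dom s) (germ_dom t)) (germ_dom r) `<=`
  opensI (opensI (germ_dom s) (germ_dom r)) (opensI (germ_dom t) (germ_dom r)).
  by move=> y [[? ?] ?].
exists _, (@subset_refl _ _), h; split.
  by split; [split|]; exact: germ_in.
rewrite /= res_id !(rmorphD, rmorphM) /= !resK mulrDl.
by congr (_ * _ + _ * _); exact: res_irr.
Qed.

Definition germ_preRing : preRing :=
  PreRing germ_eqv_refl germ_eqv_sym germ_eqv_trans germN_eqv germD_eqv
    germM_eqv germDA germDC germD0 germDN germMA germMC germM1 germMD.

Definition stalk : comPzRingType := quotRing germ_preRing.

Definition germ_at (U : opens X) (Ux : oset U x) (s : sec U) : stalk :=
  @class_of germ_preRing (Germ Ux s).

End Stalk.

(* Sections over [U] are the families of elements of the local rings [A_p],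
   [p] in [U], that are locally given by a single fraction [a / f]. *)
Section StructureSheaf.
Variable A : comPzRingType.

Section Sections.
Variable U : opens (Spec A).

Definition locally_fraction
    (s : forall p : Spec A, oset U p -> localization p) : Prop :=
  forall p, oset U p -> exists (V : opens (Spec A)) (a f : A),
    [/\ oset V p, V `<=` U &
        forall q (Vq : oset V q) (Uq : oset U q),
          exists nf : ~ prime_of q f, s q Uq = frac a nf].

Record spec_sec := SpecSec {
  sec_fun : forall p : Spec A, oset U p -> localization p;
  sec_funP : locally_fraction sec_fun
}.

HB.instance Definition _ := gen_eqMixin spec_sec.
HB.instance Definition _ := gen_choiceMixin spec_sec.

Lemma spec_secP (s t : spec_sec) :
  (forall p (Up : oset U p), sec_fun s Up = sec_fun t Up) -> s = t.
Proof.
case: s t => [s sP] [t tP] /= st.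
have e : s = t.
  apply: functional_extensionality_dep => p.
  exact: functional_extensionality_dep (st p).
by subst t; congr (SpecSec _); exact: Prop_irrelevance.
Qed.

Lemma locally_fraction_op
    (op : forall p : Spec A, localization p -> localization p -> localization p)
    (nop dop : A -> A -> A -> A -> A) :
  (forall (p : Spec A) a f b g (nf : ~ prime_of p f) (ng : ~ prime_of p g),
    exists n : ~ prime_of p (dop a f b g),
      op p (frac a nf) (frac b ng) = frac (nop a f b g) n) ->
  forall s t : spec_sec,
  locally_fraction (fun p Up => op p (sec_fun s Up) (sec_fun t Up)).
Proof.
move=> opP s t p Up.
have [V [a [f [Vp VU sV]]]] := sec_funP s Up.
have [W [b [g [Wp WU tW]]]] := sec_funP t Up.
exists (opensI V W), (nop a f b g), (dop a f b g); split=> //.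
  by move=> q [Vq _]; exact: VU.
move=> q [Vq Wq] Uq.
have [nf ->] := sV q Vq Uq; have [ng ->] := tW q Wq Uq.
exact: opP.
Qed.

Lemma fracDE (p : Spec A) a f b g
    (nf : ~ prime_of p f) (ng : ~ prime_of p g) :
  frac a nf + frac b ng = frac (a * g + b * f) (notinM nf ng).
Proof. by rewrite /frac -class_ofD. Qed.

Lemma fracME (p : Spec A) a f b g
    (nf : ~ prime_of p f) (ng : ~ prime_of p g) :
  frac a nf * frac b ng = frac (a * b) (notinM nf ng).
Proof. by rewrite /frac -class_ofM. Qed.

Lemma fracNE (p : Spec A) a f (nf : ~ prime_of p f) :
  - frac a nf = frac (- a) nf.
Proof. by rewrite /frac -class_ofN. Qed.

Fact lf_const (a : A) :
  locally_fraction (fun p (_ : oset U p) => frac a (@notin1 A p)).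
Proof.
move=> p Up; exists U, a, 1; split=> // q _ _.
by exists (@notin1 A q).
Qed.

Definition sec_const (a : A) := SpecSec (lf_const a).

Fact lfD (s t : spec_sec) :
  locally_fraction (fun p Up => sec_fun s (p := p) Up + sec_fun t Up).
Proof.
apply: (@locally_fraction_op (fun p x y => x + y)
  (fun a f b g => a * g + b * f) (fun a f b g => f * g)).
by move=> p a f b g nf ng; exists (notinM nf ng); exact: fracDE.
Qed.

Fact lfM (s t : spec_sec) :
  locally_fraction (fun p Up => sec_fun s (p := p) Up * sec_fun t Up).
Proof.
apply: (@locally_fraction_op (fun p x y => x * y)
  (fun a f b g => a * b) (fun a f b g => f * g)).
by move=> p a f b g nf ng; exists (notinM nf ng); exact: fracME.
Qed.

Fact lfN (s : spec_sec) :
  locally_fraction (fun p Up => - sec_fun s (p := p) Up).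
Proof.
apply: (@locally_fraction_op (fun p x _ => - x)
  (fun a f b g => - a) (fun a f b g => f) _ s s).
by move=> p a f b g nf ng; exists nf; exact: fracNE.
Qed.

Definition secD s t := SpecSec (lfD s t).
Definition secM s t := SpecSec (lfM s t).
Definition secN s := SpecSec (lfN s).

Fact secDA : associative secD.
Proof. by move=> s t r; apply: spec_secP => p Up /=; rewrite addrA. Qed.
Fact secDC : commutative secD.
Proof. by move=> s t; apply: spec_secP => p Up /=; rewrite addrC. Qed.
Fact secD0 : left_id (sec_const 0) secD.
Proof.
move=> s; apply: spec_secP => p Up /=.
have -> : frac 0 (@notin1 A p) = 0 by [].
exact: add0r.
Qed.
Fact secDN : left_inverse (sec_const 0) secN secD.
Proof. by move=> s; apply: spec_secP => p Up /=; rewrite addNr. Qed.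
Fact secMA : associative secM.
Proof. by move=> s t r; apply: spec_secP => p Up /=; rewrite mulrA. Qed.
Fact secMC : commutative secM.
Proof. by move=> s t; apply: spec_secP => p Up /=; rewrite mulrC. Qed.
Fact secM1 : left_id (sec_const 1) secM.
Proof.
move=> s; apply: spec_secP => p Up /=.
have -> : frac 1 (@notin1 A p) = 1 by [].
exact: mul1r.
Qed.
Fact secMD : left_distributive secM secD.
Proof. by move=> s t r; apply: spec_secP => p Up /=; rewrite mulrDl. Qed.

HB.instance Definition _ := GRing.isZmodule.Build spec_sec
  secDA secDC secD0 secDN.
HB.instance Definition _ := GRing.Zmodule_isComPzRing.Build spec_sec
  secMA secMC secM1 secMD.

End Sections.

Section Restriction.
Variables (U V : opens (Spec A)) (VU : V `<=` U).

Fact lf_res (s : spec_sec U) :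
  @locally_fraction V (fun p Vp => sec_fun s (VU Vp)).
Proof.
move=> p Vp; have [W [a [f [Wp WU sW]]]] := sec_funP s (VU Vp).
exists (opensI W V), a, f; split=> //; first by move=> q [].
by move=> q [Wq _] Vq; exact: sW.
Qed.

Definition spec_res (s : spec_sec U) : spec_sec V := SpecSec (lf_res s).

Fact spec_res_zmod : zmod_morphism spec_res.
Proof. by move=> s t; apply: spec_secP. Qed.
Fact spec_res_monoid : monoid_morphism spec_res.
Proof. by split=> [|s t]; apply: spec_secP. Qed.

HB.instance Definition _ := GRing.isZmodMorphism.Build
  (spec_sec U) (spec_sec V) spec_res spec_res_zmod.
HB.instance Definition _ := GRing.isMonoidMorphism.Build
  (spec_sec U) (spec_sec V) spec_res spec_res_monoid.

End Restriction.

Fact spec_glue (U : opens (Spec A)) (I : Type) (V : I -> opens (Spec A))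
    (VU : forall i, V i `<=` U) : U `<=` \bigcup_i V i ->
  forall s : (forall i, spec_sec (V i)),
  (forall i j,
     spec_res (U := V i) (V := opensI (V i) (V j)) (@subIsetl _ _ _) (s i)
   = spec_res (U := V j) (V := opensI (V i) (V j)) (@subIsetr _ _ _) (s j)) ->
  exists! t : spec_sec U, forall i, spec_res (VU i) t = s i.
Proof.
move=> cov s sE.
have sE' i j p (Vi : oset (V i) p) (Vj : oset (V j) p) :
    sec_fun (s i) Vi = sec_fun (s j) Vj.
  have /(congr1 (fun t : spec_sec (opensI (V i) (V j)) =>
    sec_fun t (conj Vi Vj : oset (opensI (V i) (V j)) p))) /= := sE i j.
  by rewrite (Prop_irrelevance (subIsetl _) Vi) (Prop_irrelevance (subIsetr _) Vj).
have ex p (Up : oset U p) : exists i, oset (V i) p.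
  by have [i _ Vp] := cov p Up; exists i.
pose t p Up := sec_fun (s (projT1 (cid (ex p Up)))) (projT2 (cid (ex p Up))).
have tE p Up i (Vi : oset (V i) p) : t p Up = sec_fun (s i) Vi by exact: sE'.
have tP : locally_fraction t.
  move=> p Up; have [i _ Vp] := cov p Up.
  have [W [a [f [Wp WV sW]]]] := sec_funP (s i) Vp.
  exists W, a, f; split=> //; first exact: subset_trans (VU i).
  move=> q Wq Uq; have [nf e] := sW q Wq (WV q Wq).
  by exists nf; rewrite (tE q Uq i (WV q Wq)).
exists (SpecSec tP); split=> [i|t' t'E].
  by apply: spec_secP => p Vp /=; exact: tE.
apply: spec_secP => p Up /=; have [i _ Vp] := cov p Up.
rewrite (tE p Up i Vp) -t'E /=; congr sec_fun; exact: Prop_irrelevance.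
Qed.

Fact spec_res_id (U : opens (Spec A)) (UU : U `<=` U) (s : spec_sec U) :
  spec_res UU s = s.
Proof.
by apply: spec_secP => p Up /=; congr sec_fun; exact: Prop_irrelevance.
Qed.

Fact spec_res_comp (U V W : opens (Spec A)) (VU : V `<=` U) (WV : W `<=` V)
  (WU : W `<=` U) (s : spec_sec U) :
  spec_res WV (spec_res VU s) = spec_res WU s.
Proof.
by apply: spec_secP => p Wp /=; congr sec_fun; exact: Prop_irrelevance.
Qed.

Definition affine_scheme : ringedSpace :=
  @RingedSpace (Spec A) (fun U => spec_sec U) (fun U V VU => spec_res VU)
    spec_res_id spec_res_comp spec_glue.

End StructureSheaf.

Section OpenSubspace.
Variables (X : ringedSpace) (U : opens X).

Definition open_sec (V : opens (set_type U)) : comPzRingType :=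
  sec (image_opens V).

Definition open_res (V W : opens (set_type U)) (WV : W `<=` V) :
    {rmorphism open_sec V -> open_sec W} :=
  res (image_opensS WV).

Fact open_glue (V : opens (set_type U)) (I : Type)
    (W : I -> opens (set_type U)) (WV : forall i, W i `<=` V) :
  V `<=` \bigcup_i W i ->
  forall s : (forall i, open_sec (W i)),
  (forall i j,
     open_res (V := W i) (W := opensI (W i) (W j)) (@subIsetl _ _ _) (s i)
   = open_res (V := W j) (W := opensI (W i) (W j)) (@subIsetr _ _ _) (s j)) ->
  exists! t : open_sec V, forall i, open_res (WV i) t = s i.
Proof.
move=> cov s sE; apply: (res_glue (V := fun i => image_opens (W i))).
  by move=> _ [y Vy <-]; have [i _ Wy] := cov y Vy; exists i => //; exists y.
move=> i j.
have h : opensI (image_opens (W i)) (image_opens (W j)) `<=`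
    image_opens (opensI (W i) (W j)).
  move=> _ [[y Wy <-] [z Wz /val_inj zy]]; exists y => //.
  by split=> //; rewrite -zy.
have /(congr1 (res h)) := sE i j.
rewrite /open_res !resK => e.
exact: (etrans (res_irr _ _ _) (etrans e (res_irr _ _ _))).
Qed.

Definition open_subspace : ringedSpace :=
  @RingedSpace (set_type U) open_sec open_res
    (fun V VV s => res_id (image_opensS VV) s)
    (fun V W Z WV ZW ZV s =>
      res_comp (image_opensS WV) (image_opensS ZW) (image_opensS ZV) s)
    open_glue.

End OpenSubspace.

Record rs_morphism (X Y : ringedSpace) := RsMorphism {
  rs_map : X -> Y;
  rs_cont : continuous rs_map;
  rs_sharp : forall V : opens Y,
    {rmorphism sec V -> sec (preimage_opens rs_cont V)};
  rs_natural : forall (V W : opens Y) (WV : W `<=` V) (s : sec V),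
    res (preimage_opensS (cf := rs_cont) WV) (rs_sharp V s)
    = rs_sharp W (res WV s)
}.

(* An isomorphism is a homeomorphism with an isomorphism of sheaves; between
   locally ringed spaces such a morphism is automatically local. *)
Definition rs_isomorphic (X Y : ringedSpace) : Prop :=
  exists f : rs_morphism X Y,
    (exists g : Y -> X, [/\ cancel (rs_map f) g, cancel g (rs_map f)
                          & continuous g]) /\
    (forall V : opens Y, bijective (rs_sharp f V)).

Definition is_affine (X : ringedSpace) : Prop :=
  exists A : comPzRingType, rs_isomorphic X (affine_scheme A).

Record scheme := Scheme {
  scheme_space :> ringedSpace;
  scheme_stalk_local : forall x : scheme_space, local_ring (stalk x);
  scheme_locally_affine : forall x : scheme_space,
    exists2 U : opens scheme_space, oset U x & is_affine (open_subspace U)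
}.

Definition pointwise_irreducible (X : scheme) : Prop :=
  forall x : X, irreducible_ring (stalk x).

(* Main.v *)
Require Import Defs.
From mathcomp Require Import all_boot all_algebra.
From mathcomp Require Import all_classical topology.
From mathcomp Require Import ring.

(**
  Near a point [x] of an affine chart [Spec A], irreducibility of the local
  ring at [x] means that 1 is not nilpotent and that the nilpotent germs form
  a prime ideal; and the germ of [a / f] is nilpotent exactly when [D(a)]
  misses a neighbourhood of [x].  If [x] has an irreducible open neighbourhood
  [N], two open sets [D(a)], [D(b)] meeting all small neighbourhoods of [x]
  meet each other inside [N], so the local ring is irreducible.  Conversely,
  suppose that two distinct components [Z], [Z'] contain [x] and that [Irr] is
  locally finite.  Removing from a neighbourhood of [x] the components other
  than [Z], respectively [Z] itself, gives disjoint open sets meeting [Z] and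
  [Z'].  They contain some [D(a)] and [D(b)] meeting [Z] and [Z'], hence
  having [x] in their closures: [a] and [b] are not nilpotent at [x] but [a b]
  is.  So pointwise irreducibility and local finiteness put a single component
  through each point, and it contains a neighbourhood of that point.  Finally,
  in a locally irreducible space the components are open and closed.
*)

Set Implicit Arguments.
Unset Strict Implicit.
Unset Printing Implicit Defensive.

Import GRing.Theory.

Local Open Scope classical_set_scope.
Local Open Scope ring_scope.

(** * Irreducible spaces and subsets *)

Lemma irreducible_spaceP (T : topologicalType) :
  irreducible_space T <-> [set: T] !=set0 /\
  forall U V : set T, open U -> open V -> U !=set0 -> V !=set0 ->
    U `&` V !=set0.
Proof.
split=> [iT|[T0 T2] F].
  split=> [|U V oU oV U0 V0].
    by have [//|x _] := iT set0 (finite_set0 _); exists x.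
  have [|x xUV] := iT _ (finite_set2 U V); first by move=> W [] ->.
  by exists x; split; apply: xUV; [left | right].
move=> /finite_seqP[s ->] {F} sP.
(* Openness is carried through the induction because the two-set hypothesis is applied to the
   intersection of the tail. *)
suff [o0 [x xs]] : open (\bigcap_(U in [set` s]) U) /\
    \bigcap_(U in [set` s]) U !=set0 by exists x.
elim: s sP => [|U s IHs] sP.
  by rewrite set_nil bigcap_set0; split=> //; exact: openT.
have [|oI I0] := IHs.
  by move=> V /= Vs; apply: sP; rewrite /= inE Vs orbT.
have [|oU U0] := sP U; first by rewrite /= inE eqxx.
have -> : [set` U :: s] = U |` [set` s].
  by apply/seteqP; split=> V /=; rewrite inE => /predU1P.
rewrite bigcap_setU1; split; first exact: openI.
exact: T2.
Qed.

(** Lets most later arguments stay in the ambient space [T], away from the type [set_type Z]. *)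
Lemma irreducible_setP (T : topologicalType) (Z : set T) :
  irreducible_set Z <-> Z !=set0 /\
  forall U V : set T, open U -> open V -> Z `&` U !=set0 -> Z `&` V !=set0 ->
    Z `&` (U `&` V) !=set0.
Proof.
have meetE (U : set T) : Z `&` U !=set0 <->
    (set_val @^-1` U : set (set_type Z)) !=set0.
  split=> [[x [Zx Ux]]|[x Ux]]; first by exists (SigSub (mem_set Zx)).
  by exists (set_val x); split=> //; exact: set_valP.
split=> [/irreducible_spaceP[[z _] Z2]|[[z Zz] Z2]].
  split=> [|U V oU oV /meetE U0 /meetE V0].
    by exists (set_val z); exact: set_valP.
  by apply/meetE; apply: (Z2 _ _ _ _ U0 V0); [exists U | exists V].
apply/irreducible_spaceP; split=> [|_ _ [U oU <-] [V oV <-] U0 V0].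
  by exists (SigSub (mem_set Zz)).
by apply/(meetE (U `&` V)); apply: Z2 => //; exact/meetE.
Qed.

(** Otherwise the traces on [Z] of the complements of the members of [F] would be finitely many
    nonempty open sets with empty intersection. *)
Lemma irreducible_sub_bigcup (T : topologicalType) (Z : set T)
    (F : set (set T)) : irreducible_set Z -> finite_set F ->
  (forall W, F W -> closed W) -> Z `<=` \bigcup_(W in F) W ->
  exists2 W, F W & Z `<=` W.
Proof.
move=> iZ finF cF ZF; apply: contrapT => nF.
have [|_ [W FW <-]|z zF] :=
  iZ ((fun W => set_val @^-1` (~` W) : set (set_type Z)) @` F).
- exact: finite_image.
- split; first by exists (~` W) => //; by apply: closed_openC; exact: cF.
  have /existsNP[z /not_implyP[Zz nWz]] : ~ Z `<=` W.
    by move=> ZW; apply: nF; exists W.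
  by exists (SigSub (mem_set Zz)).
have [W FW Wz] := ZF _ (set_valP z).
by apply: (zF (set_val @^-1` (~` W))) => //; exists W.
Qed.

(** * Irreducible components, local finiteness and connectedness *)

Section Components.
Variable T : topologicalType.
Implicit Types (Z N U V : set T).

Lemma irreducible_setT : irreducible_set [set: T] <-> irreducible_space T.
Proof.
rewrite irreducible_setP irreducible_spaceP.
by split=> -[T0 T2]; split=> // U V oU oV; have := T2 U V oU oV; rewrite !setTI.
Qed.

Lemma irreducible_set1 (x : T) : irreducible_set [set x].
Proof.
apply/irreducible_setP; split=> [|U V _ _ [_ [-> Ux]] [_ [-> Vx]]].
  by exists x.
by exists x.
Qed.

(** The last hypothesis is density of [N] in [Z]. This is the common tool for closures and for
    enlarging a component by maximality. *)
Lemma irreducible_dense Z N : irreducible_set N -> N `<=` Z ->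
  (forall U, open U -> Z `&` U !=set0 -> N `&` U !=set0) -> irreducible_set Z.
Proof.
move=> /irreducible_setP[[x Nx] N2] NZ ZN; apply/irreducible_setP; split.
  by exists x; exact: NZ.
move=> U V oU oV /(ZN _ oU) U0 /(ZN _ oV) V0.
by have [y [Ny UVy]] := N2 _ _ oU oV U0 V0; exists y; split=> //; exact: NZ.
Qed.

Lemma irreducible_setI Z U : irreducible_set Z -> open U -> Z `&` U !=set0 ->
  irreducible_set (Z `&` U).
Proof.
move=> /irreducible_setP[_ Z2] oU U0; apply/irreducible_setP; split=> //.
move=> V W oV oW; rewrite -!setIA => V0 W0.
have [y [Zy [[Uy Vy] [_ Wy]]]] := Z2 _ _ (openI oU oV) (openI oU oW) V0 W0.
by exists y.
Qed.

Lemma irreducible_closure Z : irreducible_set Z -> irreducible_set (closure Z).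
Proof.
move=> iZ; apply: (irreducible_dense iZ); first exact: subset_closure.
by move=> U oU [x [Zx Ux]]; apply: Zx; exact: open_nbhs_nbhs.
Qed.

(** Two points of the union of a chain lie in a single member, whose irreducibility applies. *)
Lemma irreducible_bigcup (F : set (set T)) :
  F !=set0 -> total_on F subset -> F `<=` @irreducible_set T ->
  irreducible_set (\bigcup_(Z in F) Z).
Proof.
move=> [Z0 FZ0] totF iF; apply/irreducible_setP; split.
  have /irreducible_setP[[x Zx] _] := iF Z0 FZ0.
  by exists x, Z0.
move=> U V oU oV [x [[Z FZ Zx] Ux]] [y [[Z' FZ' Zy] Vy]].
have [W [FW Wx Wy]] : exists W, [/\ F W, W x & W y].
  by have [ZZ'|Z'Z] := totF _ _ FZ FZ'; [exists Z' | exists Z]; split=> //;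
    [exact: ZZ' | exact: Z'Z].
have /irreducible_setP[_ W2] := iF W FW.
have [||z [Wz UVz]] := W2 U V oU oV; [by exists x | by exists y |].
by exists z; split=> //; exists W.
Qed.

Lemma Irr_cover (x : T) : exists2 Z, Irr T Z & Z x.
Proof.
pose P Z := Z = set0 \/ irreducible_set Z /\ Z x.
have [|Z [PZ maxZ]] := @Zorn_bigcup T P.
  move=> F FP totF.
  have [[Z [FZ Z0]]|F0] := pselect (exists Z, F Z /\ Z <> set0); last first.
    left; rewrite -subset0 => y [Z FZ Zy]; apply: F0.
    by exists Z; split=> // Z0; rewrite Z0 in Zy.
  right; pose G := F `&` [set Z | Z <> set0].
  have -> : \bigcup_(Z in F) Z = \bigcup_(Z in G) Z.
    apply/seteqP; split=> y [W]; last by move=> [FW _] Wy; exists W.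
    by move=> FW Wy; exists W => //; split=> //= W0; rewrite W0 in Wy.
  have GP W : G W -> irreducible_set W /\ W x.
    by move=> [FW W0]; case: (FP W FW).
  split; last by exists Z; [| case: (GP Z)].
  apply: irreducible_bigcup.
  - by exists Z.
  - by move=> V W [FV _] [FW _]; exact: totF.
  - by move=> W /GP[].
have [iZ Zx] : irreducible_set Z /\ Z x.
  case: PZ => // Z0; exfalso; apply: (maxZ [set x]).
    by rewrite Z0; split=> // /(_ x erefl).
  by right; split; first exact: irreducible_set1.
exists Z => //; split=> // Z' iZ' ZZ'; apply: contrapT => nZ.
apply: (maxZ Z'); last by right; split=> //; exact: ZZ'.
by split=> // Z'Z; apply: nZ; apply/seteqP.
Qed.

Lemma Irr_closed Z : Irr T Z -> closed Z.
Proof.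
move=> [iZ maxZ]; rewrite -(maxZ (closure Z)); first exact: closed_closure.
  exact: irreducible_closure.
exact: subset_closure.
Qed.

(** An open set meeting [Z] also meets [Z] inside [N], so [N] is dense in the union of [Z] and [N].
    That union is irreducible, hence equal to [Z] by maximality. *)
Lemma open_irreducible_sub_Irr Z N : Irr T Z -> open N -> irreducible_set N ->
  Z `&` N !=set0 -> N `<=` Z.
Proof.
move=> [iZ maxZ] oN iN ZN; rewrite -(maxZ (Z `|` N)) //.
apply: (irreducible_dense iN) => // U oU [x [[Zx|Nx] Ux]]; last by exists x.
have /irreducible_setP[_ Z2] := iZ.
by have [|y [_]] := Z2 N U oN oU ZN; [exists x | exists y].
Qed.

(** [N] lies in both components and is dense in each, so their union is irreducible and equals
    both. *)
Lemma Irr_uniq Z Z' N : Irr T Z -> Irr T Z' -> open N -> irreducible_set N ->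
  Z `&` N !=set0 -> Z' `&` N !=set0 -> Z = Z'.
Proof.
move=> IZ IZ' oN iN ZN Z'N.
have NZ := open_irreducible_sub_Irr IZ oN iN ZN.
have NZ' := open_irreducible_sub_Irr IZ' oN iN Z'N.
have [iZ maxZ] := IZ; have [iZ' maxZ'] := IZ'.
suff iU : irreducible_set (Z `|` Z').
  exact: (etrans (esym (maxZ _ iU (@subsetUl _ _ _)))
                 (maxZ' _ iU (@subsetUr _ _ _))).
have dense W U : irreducible_set W -> W `&` N !=set0 -> open U ->
    W `&` U !=set0 -> N `&` U !=set0.
  move=> /irreducible_setP[_ W2] WN oU WU.
  by have [y [_ NUy]] := W2 N U oN oU WN WU; exists y.
apply: (irreducible_dense iN); first exact: subset_trans (@subsetUl _ _ _).
by move=> U oU [x [[Zx|Zx] Ux]];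
  [apply: (dense Z) | apply: (dense Z')] => //; exists x.
Qed.

Lemma open_irreducible_nbhs (x : T) : locally_irreducible T ->
  exists N, [/\ open N, irreducible_set N & N x].
Proof.
move=> /(_ x)[N Nx iN]; exists (N `&` N°).
rewrite setIidr; last exact: interior_subset.
split; [exact: open_interior | | exact: Nx].
rewrite -(setIidr (@interior_subset _ N)).
apply: irreducible_setI => //; first exact: open_interior.
by exists x; split; [exact: nbhs_singleton | exact: Nx].
Qed.

Lemma locally_irreducible_finite :
  locally_irreducible T -> locally_finite (Irr T).
Proof.
move=> liT x; have [N [oN iN Nx]] := open_irreducible_nbhs x liT.
exists N; first exact: open_nbhs_nbhs.
have [Z IZ Zx] := Irr_cover x.
apply: (@sub_finite_set _ _ [set Z]); last exact: finite_set1.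
move=> Z' [IZ' Z'N]; apply: (Irr_uniq IZ' IZ oN iN Z'N).
by exists x.
Qed.

Lemma irreducible_connected : irreducible_space T -> connected [set: T].
Proof.
move=> /irreducible_spaceP[_ T2] B B0 [C oC]; rewrite setTI => BC.
subst C => -[C cC]; rewrite setTI => BC; subst C.
apply: contrapT => BT; have BC0 : ~` B !=set0.
  apply/set0P/eqP => /(congr1 setC); rewrite setCK setC0; exact: BT.
by have [x []] := T2 B (~` B) oC (closed_openC cC) B0 BC0.
Qed.

Lemma connected_locally_irreducible : [set: T] !=set0 -> connected [set: T] ->
  locally_irreducible T -> irreducible_space T.
Proof.
move=> [x _] cT liT; apply/irreducible_setT.
have [Z IZ Zx] := Irr_cover x.
suff <- : Z = [set: T] by case: IZ.
apply: cT; first by exists x.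
- exists Z; last by rewrite setTI.
  (* Openness of [Z]: an irreducible open neighbourhood of a point of [Z] is contained in [Z]. *)
  rewrite openE => y Zy.
  have [N [oN iN Ny]] := open_irreducible_nbhs y liT.
  apply: (filterS (open_irreducible_sub_Irr IZ oN iN _)); first by exists y.
  exact: open_nbhs_nbhs.
- by exists Z; [exact: Irr_closed | rewrite setTI].
Qed.

(** The components that meet a given neighbourhood but avoid [x] are closed and finite in number, so
    they can be removed from it. *)
Lemma locally_finite_Irr_nbhs (x : T) : locally_finite (Irr T) ->
  exists N, [/\ open N, N x, finite_set [set Z | Irr T Z /\ Z `&` N !=set0] &
    forall Z, Irr T Z -> Z `&` N !=set0 -> Z x].
Proof.
move=> /(_ x)[N0]; rewrite nbhsE => -[N [oN Nx] NN0] finN0.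
have finN : finite_set [set Z | Irr T Z /\ Z `&` N !=set0].
  apply: sub_finite_set finN0 => Z [IZ [y [Zy Ny]]].
  by split=> //; exists y; split=> //; exact: NN0.
pose F := [set Z | (Irr T Z /\ Z `&` N !=set0) /\ ~ Z x].
have finF : finite_set F by apply: sub_finite_set finN => Z [].
exists (N `&` ~` \bigcup_(Z in F) Z); split.
- apply: openI => //; apply: closed_openC.
  apply: closed_bigcup => // Z [[IZ _] _].
  exact: Irr_closed.
- by split=> // -[Z [_ nZx]].
- by apply: sub_finite_set finN => Z [IZ [y [Zy [Ny _]]]]; split=> //; exists y.
- move=> Z IZ [y [Zy [Ny nFy]]]; apply: contrapT => nZx; apply: nFy.
  by exists Z => //; split=> //; split=> //; exists y.
Qed.

(* The topological trace of the irreducibility of the local ring at [x]: in a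
   scheme the sets [D1], [D2] are loci [D(a)], [D(b)] in an affine chart [V]. *)
Definition separated_germs (x : T) := exists V, [/\ open V, V x &
  forall U1 U2 y1 y2, open U1 -> open U2 -> (V `&` U1) y1 -> (V `&` U2) y2 ->
  exists D1 D2, [/\ open D1 /\ open D2, D1 `<=` U1 /\ D2 `<=` U2,
    D1 y1 /\ D2 y2 &
    closure D1 x -> closure D2 x -> D1 `&` D2 !=set0]].

Lemma Irr_local_uniq (x : T) Z Z' : locally_finite (Irr T) ->
  separated_germs x -> Irr T Z -> Irr T Z' -> Z x -> Z' x -> Z = Z'.
Proof.
move=> lfT [V [oV Vx VD]] IZ IZ' Zx Z'x; apply: contrapT => nZ.
have [N [oN Nx finN _]] := locally_finite_Irr_nbhs x lfT.
(* Inside the irreducible set [W], the open set [D] meets every neighbourhood of [x]. *)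
have clos W D y : Irr T W -> W x -> W y -> open D -> D y -> closure D x.
  move=> [/irreducible_setP[_ W2] _] Wx Wy oD Dy B.
  rewrite nbhsE => -[B' [oB' B'x] B'B].
  have [||z [_ [Dz B'z]]] := W2 D B' oD oB'; [by exists y | by exists x |].
  by exists z; split=> //; exact: B'B.
pose F := [set W | (Irr T W /\ W `&` N !=set0) /\ W <> Z].
have finF : finite_set F by apply: sub_finite_set finN => W [].
have cF : closed (\bigcup_(W in F) W).
  by apply: closed_bigcup => // W [[IW _] _]; exact: Irr_closed.
have [iZ maxZ] := IZ; have [iZ' maxZ'] := IZ'.
(* The neighbourhood [V] cut with [N] and the complement of [A] both meet [W], hence meet each other
   inside [W]. *)
have sep W (A : set T) : irreducible_set W -> W x -> closed A -> ~ W `<=` A ->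
    exists2 y, W y & (V `&` (N `&` ~` A)) y.
  move=> /irreducible_setP[_ W2] Wx cA WA.
  have [||y [Wy [[Vy Ny] Ay]]] := W2 _ _ (openI oV oN) (closed_openC cA).
  - by exists x.
  - by apply: contrapT => nW; apply: WA => y Wy; apply: contrapT => nAy;
      apply: nW; exists y.
  - by exists y.
(* If the finitely many members of [F] covered [Z], one of them would contain [Z] and equal it by
   maximality. *)
have [] := sep Z (\bigcup_(W in F) W) iZ Zx cF.
  move=> /(irreducible_sub_bigcup iZ finF)[W [[IW _] _]|W [[[iW _] _] WZ] ZW].
    exact: Irr_closed.
  by apply: WZ; exact: maxZ.
move=> y1 Zy1 U1y1.
have [] := sep Z' Z iZ' Z'x (Irr_closed IZ).
  by move=> Z'Z; apply: nZ; exact: maxZ'.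
move=> y2 Zy2 U2y2.
have oU1 := openI oN (closed_openC cF).
have oU2 := openI oN (closed_openC (Irr_closed IZ)).
have [D1 [D2 [[oD1 oD2] [D1U D2U] [D1y D2y] D12]]] :=
  VD _ _ _ _ oU1 oU2 U1y1 U2y2.
have [z [/D1U[Nz nFz] /D2U[_ nZz]]] := D12 (clos _ _ _ IZ Zx Zy1 oD1 D1y)
  (clos _ _ _ IZ' Z'x Zy2 oD2 D2y).
(* The point [z] of [N] lies outside [Z] and outside every other component meeting [N], yet some
   component contains it. *)
have [W IW Wz] := Irr_cover z.
apply: nFz; exists W => //; split; last by move=> WZ; apply: nZz; rewrite -WZ.
by split=> //; exists z.
Qed.

(** Choose a neighbourhood such that every component meeting it passes through [x]. Only one
    component does, so the neighbourhood is an open part of that component. *)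
Lemma locally_finite_locally_irreducible : locally_finite (Irr T) ->
  (forall x, separated_germs x) -> locally_irreducible T.
Proof.
move=> lfT sepT x.
have [N [oN Nx _ Nuniq]] := locally_finite_Irr_nbhs x lfT.
have [Z IZ Zx] := Irr_cover x.
exists N; first exact: open_nbhs_nbhs.
suff NZ : N `<=` Z.
  rewrite -(setIidr NZ); apply: irreducible_setI => //; first by case: IZ.
  by exists x.
move=> y Ny; have [W IW Wy] := Irr_cover y.
rewrite (@Irr_local_uniq x Z W) //; apply: Nuniq => //; by exists y.
Qed.

End Components.

(** * Nilpotent elements, primes and irreducible rings *)

Definition nilpotent (A : comPzRingType) (a : A) := exists n, a ^+ n = 0.

Lemma prime_nilpotent (A : comPzRingType) (p : Spec A) (a : A) :
  nilpotent a -> prime_of p a.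
Proof.
have [[p0 _ _] p1 pp] := prime_ofP p.
case=> n an; have : prime_of p (a ^+ n) by rewrite an.
by elim: n {an} => [//|n IHn]; rewrite exprS => /pp[].
Qed.

(** An ideal maximal among those containing no power of [a] is prime. *)
Lemma prime_avoiding (A : comPzRingType) (a : A) :
  ~ nilpotent a -> exists p : Spec A, ~ prime_of p a.
Proof.
(* The empty set again serves the empty chain; the zero ideal, which avoids the powers of [a],
   excludes it as a maximal element. *)
move=> na; pose P I := I = set0 \/ is_ideal I /\ forall n, ~ I (a ^+ n).
have [F FP totF|I [PI maxI]] := @Zorn_bigcup A P.
  have [F0|] := pselect (\bigcup_(I in F) I = set0); first by left.
  move=> /eqP/set0P[x [I0 FI0 I0x]].
  have FE I y : F I -> I y -> is_ideal I /\ forall n, ~ I (a ^+ n).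
    by move=> FI Iy; case: (FP _ FI) => // I_0; rewrite I_0 in Iy.
  right; split; last first.
    by move=> n [I FI Ia]; have [_ /(_ n)] := FE _ _ FI Ia.
  split.
  - by exists I0 => //; have [[]] := FE _ _ FI0 I0x.
  - move=> y z [I FI Iy] [J FJ Jz].
    have [K [FK Ky Kz]] : exists K, [/\ F K, K y & K z].
      by have [IJ|JI] := totF _ _ FI FJ; [exists J | exists I]; split=> //;
        [exact: IJ | exact: JI].
    by exists K => //; have [[_ + _] _] := FE _ _ FK Ky; apply.
  - move=> b y [I FI Iy]; exists I => //.
    by have [[_ _ +] _] := FE _ _ FI Iy; apply.
have [[I0 ID IM] Ia] : is_ideal I /\ forall n, ~ I (a ^+ n).
  case: PI => // I0; exfalso; apply: (maxI [set 0]).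
    by rewrite I0; split=> // /(_ 0 erefl).
  right; split; last by move=> n an; apply: na; exists n.
  by split=> [//|_ _ -> ->|b _ ->]; rewrite /= ?addr0 ?mulr0.
(* The ideal generated by [I] and [x] is strictly larger than [I], hence contains a power of [a]. *)
have ext x : ~ I x -> exists n i r, I i /\ a ^+ n = i + r * x.
  move=> nIx; apply: contrapT => nex.
  apply: (maxI [set y | exists i r, I i /\ y = i + r * x]).
    split=> [y Iy|sub]; first by exists y, 0; rewrite mul0r addr0.
    by apply/nIx/sub; exists 0, 1; rewrite mul1r add0r.
  right; split; last by move=> n [i [r e]]; apply: nex; exists n, i, r.
  split.
  - by exists 0, 0; rewrite mul0r addr0.
  - move=> _ _ [i [r [Ii ->]]] [j [s [Ij ->]]].
    by exists (i + j), (r + s); split; [exact: ID | ring].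
  - move=> b _ [i [r [Ii ->]]].
    by exists (b * i), (b * r); split; [exact: IM | ring].
have pI : is_prime I.
  split=> // [I1|x y Ixy]; first exact: (Ia 0%N).
  apply: contrapT => /not_orP[/ext[n [i [r [Ii en]]]] /ext[m [j [s [Ij em]]]]].
  apply: (Ia (n + m)%N); rewrite exprD en em.
  (* Each term on the right is a multiple of [i], [j] or [x * y], all in [I], so [I] would contain a
     power of [a]. *)
  have -> : (i + r * x) * (j + s * y) =
    (j + s * y) * i + (r * x * j + r * s * (x * y)) by ring.
  exact: (ID _ _ (IM _ _ Ii) (ID _ _ (IM _ _ Ij) (IM _ _ Ixy))).
by exists (MkSpec pI); have := Ia 1%N; rewrite expr1.
Qed.

Definition basic_open (A : comPzRingType) (a : A) : set (Spec A) :=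
  [set p | ~ prime_of p a].

Lemma basic_openP (A : comPzRingType) (a : A) : open (basic_open a).
Proof.
exists [set a]; apply/seteqP; split=> p /= npa; first by move/(_ a erefl).
by move=> pa; apply: npa => _ ->.
Qed.

Definition basic_opens (A : comPzRingType) (a : A) := Opens (basic_openP a).

Lemma basic_open_nbhs (A : comPzRingType) (O : set (Spec A)) (p : Spec A) :
  open O -> O p -> exists2 a, ~ prime_of p a & basic_open a `<=` O.
Proof.
move=> [E ->] /existsNP[a /not_implyP[Ea npa]]; exists a => // q nqa Eq.
exact/nqa/Eq.
Qed.

(** The sets [D(a)] form a basis of the spectrum, [D(a)] and [D(b)] meet in [D(ab)], and [D(a)] is
    empty exactly when [a] is nilpotent. *)
Lemma irreducible_ringP (A : comPzRingType) :
  irreducible_ring A <-> (1 : A) <> 0 /\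
  forall a b : A, nilpotent (a * b) -> nilpotent a \/ nilpotent b.
Proof.
rewrite /irreducible_ring irreducible_spaceP; split.
  move=> [[p _] A2]; split=> [A0|a b nab].
    by have [[p0 _ _] + _] := prime_ofP p; rewrite A0.
  apply: contrapT => /not_orP[/prime_avoiding[q qa] /prime_avoiding[r rb]].
  have [||s [sa sb]] := A2 _ _ (basic_openP a) (basic_openP b).
  - by exists q.
  - by exists r.
  by apply: (notinM sa sb); exact: prime_nilpotent.
move=> [A1 A2]; split=> [|U V oU oV [p Up] [q Vq]].
  have [|p _] := @prime_avoiding A 1; last by exists p.
  by case=> n; rewrite expr1n.
have [a pa aU] := basic_open_nbhs oU Up.
have [b qb bV] := basic_open_nbhs oV Vq.
have [|r rab] := @prime_avoiding A (a * b).
  by case/A2 => [/(prime_nilpotent p)|/(prime_nilpotent q)].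
have [[_ _ rM] _ _] := prime_ofP r.
exists r; split; [apply: aU|apply: bV] => rx; apply: rab; last exact: rM.
by rewrite mulrC; exact: rM.
Qed.

(** * Fractions and germs of sections *)

Section Fractions.
Variables (A : comPzRingType) (p : Spec A).
Implicit Types a f : A.

Lemma frac_eq0 a f (nf : ~ prime_of p f) :
  Defs.frac a nf = 0 <-> exists2 u, ~ prime_of p u & u * a = 0.
Proof.
rewrite -(class_of0 (frac_preRing p)) class_ofE /= /frac_eqv /=.
by split=> -[u nu e]; exists u => //; move: e; rewrite mulr1 mul0r subr0.
Qed.

Lemma frac_exp a f (nf : ~ prime_of p f) n :
  exists nfn : ~ prime_of p (f ^+ n),
    Defs.frac a nf ^+ n = Defs.frac (a ^+ n) nfn.
Proof.
elim: n => [|n [nfn IHn]]; first by exists (@notin1 A p).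
by rewrite !exprS IHn fracME; eexists.
Qed.

Lemma frac_nilpotent a f (nf : ~ prime_of p f) n :
  Defs.frac a nf ^+ n = 0 <-> exists2 u, ~ prime_of p u & u * a ^+ n = 0.
Proof. by have [nfn ->] := frac_exp a nf n; exact: frac_eq0. Qed.

Lemma prime_frac_nilpotent a f (nf : ~ prime_of p f) :
  nilpotent (Defs.frac a nf) -> prime_of p a.
Proof.
case=> n /frac_nilpotent[u nu ua]; apply: contrapT => npa.
have [[p0 _ _] _ _] := prime_ofP p.
have : ~ prime_of p (u * a ^+ n).
  apply: notinM => //; elim: n {ua} => [|n IHn]; first exact: notin1.
  by rewrite exprS; exact: notinM.
by rewrite ua.
Qed.

End Fractions.

Lemma sec_funX (A : comPzRingType) (O : opens (Spec A)) (s : spec_sec O) n p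
  (Op : oset O p) : sec_fun (s ^+ n) Op = sec_fun s Op ^+ n.
Proof. by elim: n => [//|n IHn]; rewrite !exprS -IHn. Qed.

Lemma germ_at_res (X : ringedSpace) (x : X) (U V : opens X) (VU : V `<=` U)
    (Vx : oset V x) (Ux : oset U x) (s : sec U) :
  germ_at Vx (res VU s) = germ_at Ux s.
Proof.
apply/class_ofE; exists V, (@subset_refl _ _), VU; split=> //=.
by rewrite res_id.
Qed.

Lemma germ_atP (X : ringedSpace) (x : X) (a : stalk x) :
  exists (U : opens X) (Ux : oset U x) (s : sec U), a = germ_at Ux s.
Proof.
case E : (rep a) => [U Ux s]; exists U, Ux, s.
by rewrite -[LHS]repK E.
Qed.

Lemma germ_at_eq0 (X : ringedSpace) (x : X) (U : opens X) (Ux : oset U x)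
    (s : sec U) :
  germ_at Ux s = 0 <->
  exists (W : opens X) (WU : W `<=` U), oset W x /\ res WU s = 0.
Proof.
rewrite -(class_of0 (germ_preRing x)) class_ofE /= /germ_eqv /=.
split=> [[W [WU [WT [Wx e]]]]|[W [WU [Wx e]]]].
  by exists W, WU; split=> //; rewrite e rmorph0.
have WT : W `<=` opensT X by [].
by exists W, WU, WT; split=> //; rewrite e rmorph0.
Qed.

Section GermMorphism.
Variables (X : ringedSpace) (x : X) (U : opens X) (Ux : oset U x).

Lemma germ_atM (s t : sec U) : germ_at Ux (s * t) = germ_at Ux s * germ_at Ux t.
Proof.
rewrite /germ_at -class_ofM; apply/class_ofE.
have h : U `<=` opensI U U by [].
exists U, (@subset_refl _ _), h; split=> //=.
by rewrite res_id rmorphM /= !resK !res_id.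
Qed.

Lemma germ_at1 : germ_at Ux (1 : sec U) = 1.
Proof.
rewrite -(class_of1 (germ_preRing x)); apply/class_ofE.
have UT : U `<=` opensT X by [].
by exists U, (@subset_refl _ _), UT; split=> //=; rewrite !rmorph1.
Qed.

Lemma germ_atX (s : sec U) n : germ_at Ux (s ^+ n) = germ_at Ux s ^+ n.
Proof.
by elim: n => [|n IHn]; rewrite ?germ_at1// !exprS germ_atM IHn.
Qed.

End GermMorphism.

(** * Affine charts and nilpotent germs *)

(** Flattens an isomorphism between an open subspace and [Spec A] into data on [X] itself. Together
    [chart_opensE] and [chart_surj] make [chart_opens O] the image of [O]. *)
Record affine_chart (X : ringedSpace) (A : comPzRingType) := AffineChart {
  chart_map : Spec A -> X;
  chart_cont : continuous chart_map;
  chart_opens : opens (Spec A) -> opens X;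
  chart_opensE : forall O p, oset (chart_opens O) (chart_map p) <-> oset O p;
  chart_surj : forall O x, oset (chart_opens O) x -> exists p, x = chart_map p;
  chart_sharp : forall O : opens (Spec A),
    {rmorphism spec_sec O -> sec (chart_opens O)};
  chart_sharp_bij : forall O, bijective (chart_sharp O);
  chart_res : forall (O O' : opens (Spec A)) (OO' : O' `<=` O)
    (h : chart_opens O' `<=` chart_opens O) (s : spec_sec O),
    res h (chart_sharp O s) = chart_sharp O' (spec_res OO' s)
}.

Lemma affine_chart_of_open (X : ringedSpace) (U : opens X) (x : X) :
  oset U x -> is_affine (open_subspace U) ->
  exists A (c : affine_chart X A) p, x = chart_map c p.
Proof.
move=> Ux [A [f [[g [fK gK cg]] fbij]]]; exists A.
pose O_ (O : opens (Spec A)) := image_opens (preimage_opens (@rs_cont _ _ f) O).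
have cmap : continuous (fun p : Spec A => set_val (g p) : X).
  move=> p; apply: continuous_comp; [exact: cg | exact: initial_continuous].
have opE (O : opens (Spec A)) p : oset (O_ O) (set_val (g p)) <-> oset O p.
  split=> [[y Oy /val_inj yE]|Op]; first by move: Oy; rewrite /= yE gK.
  by exists (g p) => //=; rewrite gK.
have sur (O : opens (Spec A)) y : oset (O_ O) y -> exists p, y = set_val (g p).
  by case=> z Oz <-; exists (rs_map f z); rewrite fK.
have nat (O O' : opens (Spec A)) (OO' : O' `<=` O) (h : O_ O' `<=` O_ O)
    (s : spec_sec O) :
    res h (rs_sharp f O s) = rs_sharp f O' (spec_res OO' s).
  by rewrite -(rs_natural f OO' s); exact: res_irr.
exists (@AffineChart X A _ cmap O_ opE sur (fun O => rs_sharp f O) fbij nat).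
by exists (rs_map f (SigSub (mem_set Ux))); rewrite /= fK.
Qed.

Lemma affine_chart_at (X : scheme) (x : X) :
  exists A (c : affine_chart X A) p, x = chart_map c p.
Proof.
by have [U Ux aU] := scheme_locally_affine x; exact: affine_chart_of_open aU.
Qed.

Section Chart.
Variables (X : ringedSpace) (A : comPzRingType) (c : affine_chart X A).
Implicit Types (O : opens (Spec A)) (p q : Spec A).

Lemma chart_in O p : oset O p -> oset (chart_opens c O) (chart_map c p).
Proof. by move/chart_opensE; exact. Qed.

Lemma chart_opensS O O' : O' `<=` O -> chart_opens c O' `<=` chart_opens c O.
Proof.
move=> OO' x O'x; have [p xE] := chart_surj O'x.
by move: O'x; rewrite xE => /chart_opensE/OO'; exact: chart_in.
Qed.

Definition chart_pre (W : opens X) : opens (Spec A) :=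
  preimage_opens (@chart_cont _ _ c) W.

Lemma chart_opens_pre (W : opens X) O : O `<=` chart_pre W ->
  chart_opens c O `<=` W.
Proof.
move=> OW x Ox; have [p xE] := chart_surj Ox.
by move: Ox; rewrite xE => /chart_opensE/OW.
Qed.

Definition chart_germ O p (Op : oset O p) (s : spec_sec O) :
    stalk (chart_map c p) :=
  germ_at (chart_in Op) (chart_sharp c O s).

Lemma chart_germM O p (Op : oset O p) (s t : spec_sec O) :
  chart_germ Op (s * t) = chart_germ Op s * chart_germ Op t.
Proof. by rewrite /chart_germ rmorphM germ_atM. Qed.

Lemma chart_germX O p (Op : oset O p) (s : spec_sec O) n :
  chart_germ Op (s ^+ n) = chart_germ Op s ^+ n.
Proof. by rewrite /chart_germ rmorphXn germ_atX. Qed.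

Lemma chart_germ_res O O' p (OO' : O' `<=` O) (O'p : oset O' p) (Op : oset O p)
  (s : spec_sec O) : chart_germ O'p (spec_res OO' s) = chart_germ Op s.
Proof.
by rewrite /chart_germ -(chart_res OO' (chart_opensS OO')); exact: germ_at_res.
Qed.

Lemma chart_germP p (a : stalk (chart_map c p)) :
  exists O (Op : oset O p) (s : spec_sec O), a = chart_germ Op s.
Proof.
have [U [Ux [t ->]]] := germ_atP a.
have h := chart_opens_pre (@subset_refl _ (chart_pre U)).
have [sinv _ sK] := chart_sharp_bij c (chart_pre U).
exists (chart_pre U), Ux, (sinv (res h t)).
by rewrite /chart_germ sK; exact/esym/germ_at_res.
Qed.

(** A germ vanishes when the section does on a smaller open set, and [chart_sharp] is injective and
    compatible with restriction. *)
Lemma chart_germ_eq0 O p (Op : oset O p) (s : spec_sec O) :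
  chart_germ Op s = 0 <-> exists O', oset O' p /\
    forall q (Oq : oset O q), oset O' q -> sec_fun s Oq = 0.
Proof.
rewrite germ_at_eq0; split=> [[W [WO [Wx e]]]|[O' [O'p e]]].
  exists (chart_pre W); split=> // q Oq Wq.
  pose O' := opensI O (chart_pre W).
  have O'O : O' `<=` O by move=> r [].
  have h : chart_opens c O' `<=` W by apply: chart_opens_pre => r [].
  have : spec_res O'O s = 0.
    apply: (bij_inj (chart_sharp_bij c O')).
    rewrite -(chart_res O'O (chart_opensS O'O)) rmorph0.
    by rewrite (res_irr _ (subset_trans h WO)) -resK e rmorph0.
  move=> /(congr1 (fun t : spec_sec O' =>
    sec_fun t (conj Oq Wq : oset O' q))) /=.
  by rewrite (Prop_irrelevance (O'O _ _) Oq).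
pose O2 := opensI O O'.
have O2O : O2 `<=` O by move=> r [].
exists (chart_opens c O2), (chart_opensS O2O); split; first exact: chart_in.
rewrite (chart_res O2O); have -> : spec_res O2O s = 0; last exact: rmorph0.
by apply: spec_secP => q [Oq O'q] /=; exact: e.
Qed.

(** Choose [D(u)] around [p] inside [O']. Every prime contains [u * a], so some power of it is zero,
    and [u ^+ m] kills [a ^+ m] at every point of [D(u)]. *)
Lemma chart_germ_nilpotent O p (Op : oset O p) (s : spec_sec O) O' a f :
  oset O' p ->
  (forall q (Oq : oset O q), exists nf : ~ prime_of q f,
    sec_fun s Oq = Defs.frac a nf) ->
  (forall q, oset O' q -> prime_of q a) -> nilpotent (chart_germ Op s).
Proof.
move=> O'p sE O'a; have [u pu uO'] := basic_open_nbhs (oset_open O') O'p.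
have [m uam] : nilpotent (u * a).
  apply: contrapT => /prime_avoiding[q]; have [[_ _ qM] _ _] := prime_ofP q.
  move=> nqua; apply: nqua; have [qu|nqu] := pselect (prime_of q u).
    by rewrite mulrC; exact: qM.
  exact/qM/O'a/uO'.
exists m; rewrite -chart_germX; apply/chart_germ_eq0.
exists (basic_opens u); split=> // q Oq qu.
rewrite sec_funX; have [nf ->] := sE q Oq.
apply/frac_nilpotent; exists (u ^+ m); last by rewrite -exprMn.
elim: m {uam} => [|m IHm]; first exact: notin1.
by rewrite exprS; exact: notinM.
Qed.

Lemma chart_germ2_frac p (x y : stalk (chart_map c p)) (W : opens (Spec A)) :
  oset W p -> exists O (Op : oset O p) (s t : spec_sec O) (a f b g : A),
    [/\ O `<=` W, x = chart_germ Op s, y = chart_germ Op t,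
        forall q (Oq : oset O q), exists nf : ~ prime_of q f,
          sec_fun s Oq = Defs.frac a nf &
        forall q (Oq : oset O q), exists ng : ~ prime_of q g,
          sec_fun t Oq = Defs.frac b ng].
Proof.
move=> Wp; have [O1 [O1p [s ->]]] := chart_germP x.
have [O2 [O2p [t ->]]] := chart_germP y.
have [V1 [a [f [V1p V1O1 sE]]]] := sec_funP s O1p.
have [V2 [b [g [V2p V2O2 tE]]]] := sec_funP t O2p.
pose O := opensI W (opensI V1 V2).
have OO1 : O `<=` O1 by move=> q [_ [/V1O1]].
have OO2 : O `<=` O2 by move=> q [_ [_ /V2O2]].
exists O, (conj Wp (conj V1p V2p)), (spec_res OO1 s), (spec_res OO2 t).
exists a, f, b, g.
split=> [q []//|||q Oq|q Oq] /=.
- exact/esym/chart_germ_res.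
- exact/esym/chart_germ_res.
- by apply: sE; case: Oq => _ [].
- by apply: tE; case: Oq => _ [].
Qed.

Lemma irreducible_nbhs_nilpotent p N (x y : stalk (chart_map c p)) :
  open N -> irreducible_set N -> N (chart_map c p) ->
  nilpotent (x * y) -> nilpotent x \/ nilpotent y.
Proof.
move=> oN /irreducible_setP[_ N2] Np.
have [O [Op [s [t [a [f [b [g [ON -> -> sE tE]]]]]]]]] :=
  chart_germ2_frac x y (W := chart_pre (Opens oN)) Np.
move=> [n]; rewrite -chart_germM -chart_germX => /chart_germ_eq0[O' [O'p O'E]].
(* [D(a)] and [D(b)] are disjoint on [O] and [O'], since the product of the two fractions is
   nilpotent in each local ring there. *)
have ab q : oset O q -> oset O' q -> ~ prime_of q a -> ~ prime_of q b -> False.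
  move=> Oq O'q nqa nqb; apply: (notinM nqa nqb).
  have [nf sqE] := sE q Oq; have [ng tqE] := tE q Oq.
  apply: (@prime_frac_nilpotent _ _ _ _ (notinM nf ng)).
  by exists n; rewrite -fracME -sqE -tqE -(O'E q Oq O'q) sec_funX.
pose D h := opensI (opensI O O') (basic_opens h).
(* An empty trace of [D(a)] or [D(b)] makes the corresponding germ nilpotent; two nonempty traces
   would meet inside [N]. *)
have [[q Daq]|Da0] := pselect (exists q, oset (D a) q); last first.
  left; apply: (chart_germ_nilpotent (O' := opensI O O') _ _ sE) => //.
  by move=> q OO'q; apply: contrapT => nqa; apply: Da0; exists q.
have [[r Dbr]|Db0] := pselect (exists r, oset (D b) r); last first.
  right; apply: (chart_germ_nilpotent (O' := opensI O O') _ _ tE) => //.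
  by move=> q' OO'q; apply: contrapT => nqb; apply: Db0; exists q'.
have meet h q' : oset (D h) q' -> N `&` chart_opens c (D h) !=set0.
  move=> Dq; exists (chart_map c q'); split; last exact: chart_in.
  by apply: ON; case: Dq => -[].
have [z [_ []]] :=
  N2 _ _ (oset_open (chart_opens c (D a))) (oset_open (chart_opens c (D b)))
    (meet _ _ Daq) (meet _ _ Dbr).
move=> Daz; have [v zE] := chart_surj Daz; move: Daz; rewrite zE.
move=> /chart_opensE[[Ov O'v] nva] /chart_opensE[_ nvb].
by case: (ab v Ov O'v nva nvb).
Qed.

Lemma irreducible_stalk_separated p :
  irreducible_ring (stalk (chart_map c p)) -> separated_germs (chart_map c p).
Proof.
move=> /irreducible_ringP[_ nilM].
pose TA := opensT (Spec A); have Tin q : oset TA q by [].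
exists (chart_opens c TA); split; [exact: oset_open | exact: chart_in | ].
move=> U1 U2 y1 y2 oU1 oU2 [Vy1] + [Vy2]; have [p1 ->] := chart_surj Vy1.
have [p2 ->] := chart_surj Vy2 => U1p U2p.
have basic U q : open U -> U (chart_map c q) ->
    exists2 a, ~ prime_of q a & chart_opens c (basic_opens a) `<=` U.
  move=> oU Uq.
  have [a qa aU] := basic_open_nbhs (oset_open (chart_pre (Opens oU))) Uq.
  by exists a => //; exact: (@chart_opens_pre (Opens oU)).
have [a p1a aU1] := basic _ _ oU1 U1p; have [b p2b bU2] := basic _ _ oU2 U2p.
exists (chart_opens c (basic_opens a)), (chart_opens c (basic_opens b)).
split; [by split; exact: oset_open | by [] | by split; exact: chart_in |].
move=> cla clb; apply: contrapT => disj.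
(* With [D(a)] and [D(b)] disjoint, every prime contains [a * b]. *)
have [n abn] : nilpotent (a * b).
  apply: contrapT => /prime_avoiding[q nqab]; apply: disj.
  have [[_ _ qM] _ _] := prime_ofP q.
  exists (chart_map c q); split; apply: chart_in => qx; apply: nqab.
    by rewrite mulrC; exact: qM.
  exact: qM.
(* A vanishing power of the germ of [d] would vanish on a neighbourhood of [p]; this neighbourhood
   contains a prime [q] of [D(d)], but nilpotency of [d] in the local ring at [q] puts [d] in
   [q]. *)
have nil d : closure (chart_opens c (basic_opens d)) (chart_map c p) ->
    ~ nilpotent (chart_germ (Tin p) (sec_const TA d)).
  move=> cld [m]; rewrite -chart_germX => /chart_germ_eq0[O [Op OE]].
  have [|z [Dz Oz]] := cld (chart_opens c O).
    by apply: open_nbhs_nbhs; split; [exact: oset_open | exact: chart_in].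
  have [q zE] := chart_surj Oz; move: Dz Oz; rewrite zE.
  move=> /chart_opensE nqd /chart_opensE Oq; apply: nqd.
  have := OE q (Tin q) Oq; rewrite sec_funX => dm.
  by apply: (@prime_frac_nilpotent _ _ _ _ (@notin1 A q)); exists m.
have [|/(nil _ cla)//|/(nil _ clb)//] :=
  nilM (chart_germ (Tin p) (sec_const TA a))
       (chart_germ (Tin p) (sec_const TA b)).
exists n; rewrite -chart_germM -chart_germX; apply/chart_germ_eq0.
exists TA; split=> // q Tq _; rewrite sec_funX.
have -> : sec_fun (sec_const TA a * sec_const TA b) Tq =
  Defs.frac a (@notin1 A q) * Defs.frac b (@notin1 A q) by [].
rewrite fracME; apply/frac_nilpotent; exists 1; first exact: notin1.
by rewrite abn mulr0.
Qed.

End Chart.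

(** * Passage from charts to schemes, and the two equivalences *)

Lemma stalk_nontrivial (X : scheme) (x : X) : (1 : stalk x) <> 0.
Proof.
have [M [[[M0 _ _] M1 _] _]] := scheme_stalk_local x.
by move=> e; apply: M1; rewrite e.
Qed.

Lemma locally_irreducible_pointwise (X : scheme) :
  locally_irreducible X -> pointwise_irreducible X.
Proof.
move=> liX x; apply/irreducible_ringP; split; first exact: stalk_nontrivial.
have [N [oN iN]] := open_irreducible_nbhs x liX.
have [A [c [p ->]]] := affine_chart_at x.
by move=> Np a b; exact: irreducible_nbhs_nilpotent Np.
Qed.

Lemma pointwise_irreducible_separated (X : scheme) (x : X) :
  pointwise_irreducible X -> separated_germs x.
Proof.
move=> /(_ x); have [A [c [p ->]]] := affine_chart_at x.
exact: irreducible_stalk_separated.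
Qed.

Theorem mainTheorem8 (X : scheme) :
  (locally_irreducible X <->
     pointwise_irreducible X /\ locally_finite (Irr X)) /\
  (irreducible_space X <->
     [/\ [set: X] !=set0, connected [set: X], pointwise_irreducible X &
         locally_finite (Irr X)]).
Proof.
have liP : locally_irreducible X <->
    pointwise_irreducible X /\ locally_finite (Irr X).
  split=> [liX|[piX lfX]].
    split; first exact: locally_irreducible_pointwise.
    exact: locally_irreducible_finite.
  apply: locally_finite_locally_irreducible => // x.
  exact: pointwise_irreducible_separated.
split=> //; split=> [iX|[X0 cX piX lfX]].
  have [X0 _] := (irreducible_spaceP X).1 iX.
  (* The whole space is an irreducible neighbourhood of each point, so the first equivalence
     applies. *)
  have /liP[piX lfX] : locally_irreducible X.
    by move=> x; exists [set: X]; [exact: filterT | exact/irreducible_setT].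
  by split=> //; exact: irreducible_connected.
by apply: connected_locally_irreducible => //; exact/liP.
Qed.
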